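(* Let $n,p$ be positive integers, let $\mathbf{B}_p(t)$ be a given $p$-dimensional basis on $[0,1]$, let $\boldsymbol{\eta}_p\in\mathbb{R}^p$, $e_p(t)=\beta(t)-\mathbf{B}_p(t)^T\boldsymbol{\eta}_p$, $\omega_p=\sup_{0\le t\le 1}|e_p(t)|$, and $\boldsymbol{\gamma}_p=A\boldsymbol{\eta}_p$, where $A$ is an invertible $p\times p$ matrix. Suppose that $\boldsymbol{\gamma}_p$ has at most $S_p$ non-zero components and that $$\delta^{V}_{2S_p}+\theta^{V}_{S_p,2S_p}<1 .$$ Suppose further that $\beta(t)$ is estimated by the FLiRTI estimate $\widehat\beta(t)=\mathbf{B}_p(t)^TA^{-1}\widehat{\boldsymbol{\gamma}}$, computed with either the Dantzig selector or the lasso, using any value $\lambda\ge 0$ of the tuning parameter such that $$\max_{1\le j\le p}|\tilde V_j^T\boldsymbol{\varepsilon}^*|\le\lambda$$ and, in the case that the lasso is used, such that $$\mathbf{u}=(D_\lambda\tilde V^T\tilde VD_\lambda)^{-1}\mathbf{1}\ge\mathbf{0}\quad\text{and}\quad\|\tilde V^T\tilde VD_\lambda\mathbf{u}\|_\infty\le 1 .$$ Then, for every $0\le t\le 1$, $$|\widehat\beta(t)-\beta(t)|\le\frac{1}{\sqrt n}\,C_{n,p}(t)\,\lambda\sqrt{S_p}+\omega_p .$$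
   Context: Model: $Y_i=\int_0^1X_i(t)\beta(t)\,dt+\varepsilon_i$, $i=1,\dots,n$ (the intercept is taken to be $0$), where $X_i:[0,1]\to\mathbb{R}$ are functional predictors, $\beta:[0,1]\to\mathbb{R}$ is the coefficient function and $\varepsilon_i$ are errors. The basis is $\mathbf{B}_p(t)=(b_1(t),\dots,b_p(t))^T$. All integrals are assumed to exist. Put $\mathbf{X}_i=\int_0^1X_i(t)\mathbf{B}_p(t)\,dt\in\mathbb{R}^p$, let $X$ be the $n\times p$ matrix with rows $\mathbf{X}_i^T$, let $V=XA^{-1}$, and let $\boldsymbol{\varepsilon}^*=(\varepsilon_1^*,\dots,\varepsilon_n^* )^T$ with $\varepsilon_i^*=\varepsilon_i+\int_0^1X_i(t)e_p(t)\,dt$. Then $\mathbf{Y}=V\boldsymbol{\gamma}_p+\boldsymbol{\varepsilon}^*$. The columns of $V$ are assumed non-zero; $\tilde V$ is $V$ with each column divided by its Euclidean norm, and $\tilde V_j$ is its $j$th column. Estimator: let $\widehat{\tilde{\boldsymbol\gamma}}$ be either a lasso solution, minimizing $\frac12\|\mathbf{Y}-\tilde V\mathbf{g}\|_2^2+\lambda\|\mathbf{g}\|_1$ over $\mathbf{g}\in\mathbb{R}^p$, or a Dantzig selector solution, minimizing $\|\mathbf{g}\|_1$ subject to $|\tilde V_j^T(\mathbf{Y}-\tilde V\mathbf{g})|\le\lambda$ for $j=1,\dots,p$. Then $\widehat{\boldsymbol\gamma}$ is obtained by dividing the $j$th component of $\widehat{\tilde{\boldsymbol\gamma}}$ by the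 Euclidean norm of the $j$th column of $V$. $D_\lambda$ is the diagonal matrix with $j$th diagonal entry $1,-1$ or $0$ according to whether the $j$th component of the lasso solution with tuning parameter $\lambda$ is positive, negative or zero; $\mathbf{1}$ is a vector of ones; vector inequalities are componentwise; the inverse of $D_\lambda\tilde V^T\tilde VD_\lambda$ is understood on the coordinates where the diagonal of $D_\lambda$ is non-zero (i.e. columns of $\tilde VD_\lambda$ that are identically zero are deleted). For an $n\times p$ matrix $Z$ and $T\subset\{1,\dots,p\}$, $Z_T$ is the $n\times|T|$ matrix obtained by standardizing the columns of $Z$ to Euclidean norm one and extracting those with indices in $T$. $\delta^Z_S$ is the smallest quantity such that $(1-\delta_S^Z)\|\mathbf{c}\|_2^2\le\|Z_T\mathbf{c}\|_2^2\le(1+\delta_S^Z)\|\mathbf{c}\|_2^2$ for all $T$ with $|T|\le S$ and all $\mathbf{c}\in\mathbb{R}^{|T|}$. For $S+S'\le p$, $\theta^Z_{S,S'}$ is the smallest quantity such that $|(Z_T\mathbf{c})^TZ_{T'}\mathbf{c}'|\le\theta^Z_{S,S'}\|\mathbf{c}\|_2\|\mathbf{c}'\|_2$ for all disjoint $T,T'$ with $|T|\le S$, $|T'|\le S'$ and all vectors $\mathbf{c},\mathbf{c}'$ of corresponding lengths. Finally, $$C_{n,p}(t)=\frac{4\alpha_{n,p}(t)}{1-\delta^V_{2S_p}-\theta^V_{S_p,2S_p}},\qquad \alpha_{n,p}(t)=\sqrt{\sum_{j=1}^p\frac{(\mathbf{B}_p(t)^TA_j^{-1})^2}{\frac1n\sum_{i=1}^n\left(\int_0^1X_i(s)\mathbf{B}_p(s)^TA_j^{-1}\,ds\right)^2}},$$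 where $A_j^{-1}$ is the $j$th column of $A^{-1}$. *)

(* Defs.v *)
From HB Require Import structures.
From mathcomp Require Import all_boot all_order all_algebra.
From mathcomp Require Import all_classical all_reals all_analysis.
Set Implicit Arguments.
Unset Strict Implicit.
Unset Printing Implicit Defensive.
Import Order.TTheory GRing.Theory Num.Theory.
Import numFieldNormedType.Exports.
Local Open Scope ring_scope.

Section Vectors.
Context {R : realType}.

Definition l1norm m (v : 'cV[R]_m) : R := \sum_(i < m) `|v i 0|.

(* The library norm on matrices, mx_norm, is the max norm. *)
Definition l2norm m (v : 'cV[R]_m) : R := Num.sqrt (\sum_(i < m) v i 0 ^+ 2).

Definition normalize_cols n p (Z : 'M[R]_(n, p)) : 'M[R]_(n, p) :=
  \matrix_(i, j) (Z i j / l2norm (col j Z)).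

Definition extract_cols n p (Z : 'M[R]_(n, p)) (T : {set 'I_p}) :
  'M[R]_(n, #|T|) := colsub (fun k : 'I_#|T| => enum_val k) Z.

Definition std_cols n p (Z : 'M[R]_(n, p)) (T : {set 'I_p}) :
  'M[R]_(n, #|T|) := extract_cols (normalize_cols Z) T.

(* The infimum is a minimum when 0 < S and 0 < p.  For S = 0 every real d
   qualifies and inf returns 0. *)
Definition restricted_isometry n p (Z : 'M[R]_(n, p)) (S : nat) : R :=
  inf [set d : R | forall (T : {set 'I_p}) (c : 'cV[R]_#|T|), (#|T| <= S)%N ->
    (1 - d) * l2norm c ^+ 2 <= l2norm (std_cols Z T *m c) ^+ 2
    /\ l2norm (std_cols Z T *m c) ^+ 2 <= (1 + d) * l2norm c ^+ 2].

(* Usually considered for S + S' <= p only; the same expression is used for all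
   S and S'.  The infimum is a minimum unless every admissible pair (T, T') has
   an empty member (S = 0, S' = 0 or p <= 1), where inf returns 0. *)
Definition restricted_orthogonality n p (Z : 'M[R]_(n, p)) (S S' : nat) : R :=
  inf [set th : R | forall (T T' : {set 'I_p})
      (c : 'cV[R]_#|T|) (c' : 'cV[R]_#|T'|),
    [disjoint T & T'] -> (#|T| <= S)%N -> (#|T'| <= S')%N ->
    `|((std_cols Z T *m c)^T *m (std_cols Z T' *m c')) 0 0|
      <= th * l2norm c * l2norm c'].

Definition lasso_objective n p (Y : 'cV[R]_n) (W : 'M[R]_(n, p)) (lambda : R)
    (g : 'cV[R]_p) : R :=
  2^-1 * l2norm (Y - W *m g) ^+ 2 + lambda * l1norm g.

Definition lasso_solution n p (Y : 'cV[R]_n) (W : 'M[R]_(n, p)) (lambda : R)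
    (g : 'cV[R]_p) : Prop :=
  forall g' : 'cV[R]_p,
    lasso_objective Y W lambda g <= lasso_objective Y W lambda g'.

Definition dantzig_feasible n p (Y : 'cV[R]_n) (W : 'M[R]_(n, p)) (lambda : R)
    (g : 'cV[R]_p) : Prop :=
  forall j : 'I_p, `|((col j W)^T *m (Y - W *m g)) 0 0| <= lambda.

Definition dantzig_solution n p (Y : 'cV[R]_n) (W : 'M[R]_(n, p)) (lambda : R)
    (g : 'cV[R]_p) : Prop :=
  dantzig_feasible Y W lambda g /\
  forall g' : 'cV[R]_p, dantzig_feasible Y W lambda g' -> l1norm g <= l1norm g'.

Definition sign_mx p (g : 'cV[R]_p) : 'M[R]_p :=
  diag_mx (\row_j Num.sg (g j 0)).

Definition active p (g : 'cV[R]_p) : {set 'I_p} :=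
  [set j | sign_mx g j j != 0].

(* W *m sign_mx g without its columns of index j such that g j 0 = 0. *)
Definition signed_active n p (W : 'M[R]_(n, p)) (g : 'cV[R]_p) :
    'M[R]_(n, #|active g|) := extract_cols (W *m sign_mx g) (active g).

(* With M := signed_active W g, the matrix M^T *m M is the block of
   D *m W^T *m W *m D, D := sign_mx g, on the coordinates where D is non-zero. *)
Definition lasso_sign_condition n p (W : 'M[R]_(n, p)) (g : 'cV[R]_p) : Prop :=
  let M := signed_active W g in
  let u := invmx (M^T *m M) *m (const_mx 1 : 'cV[R]_#|active g|) in
  [/\ M^T *m M \in unitmx,
      forall k, 0 <= u k 0
    & mx_norm (W^T *m M *m u) <= 1].

End Vectors.

Section FunctionalModel.
Context {R : realType} {n p : nat}.
Notation mu := (@lebesgue_measure R).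
Implicit Types (X : 'I_n -> R -> R) (b : 'I_p -> R -> R) (A : 'M[R]_p).

Definition integrable01 (f : R -> R) : Prop :=
  mu.-integrable `[0, 1] (EFin \o f).

Definition int01 (f : R -> R) : R := \int[mu]_(s in `[0, 1]) f s.

Definition basis_vec b (t : R) : 'cV[R]_p := \col_j b j t.

Definition basis01 b : Prop :=
  forall c : 'cV[R]_p,
    (forall t : R, 0 <= t <= 1 -> ((basis_vec b t)^T *m c) 0 0 = 0) -> c = 0.

Definition response X (beta : R -> R) (eps : 'cV[R]_n) : 'cV[R]_n :=
  \col_i (int01 (fun t => X i t * beta t) + eps i 0).

Definition basis_error b (beta : R -> R) (eta : 'cV[R]_p) (t : R) : R :=
  beta t - ((basis_vec b t)^T *m eta) 0 0.

(* Extended-real valued: +oo when the approximation error is unbounded. *)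
Definition sup_error b (beta : R -> R) (eta : 'cV[R]_p) : \bar R :=
  ereal_sup [set (`|basis_error b beta eta t|)%:E | t in `[0, 1]].

Definition predictor_mx X b : 'M[R]_(n, p) :=
  \matrix_(i, j) int01 (fun t => X i t * b j t).

Definition design X b A : 'M[R]_(n, p) := predictor_mx X b *m invmx A.

Definition eps_star X b (beta : R -> R) (eps : 'cV[R]_n) (eta : 'cV[R]_p) :
    'cV[R]_n :=
  \col_i (eps i 0 + int01 (fun t => X i t * basis_error b beta eta t)).

Definition rescale (V : 'M[R]_(n, p)) (g : 'cV[R]_p) : 'cV[R]_p :=
  \col_j (g j 0 / l2norm (col j V)).

Definition flirti b A (gammahat : 'cV[R]_p) (t : R) : R :=
  ((basis_vec b t)^T *m invmx A *m gammahat) 0 0.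

Definition alpha X b A (t : R) : R :=
  Num.sqrt (\sum_(j < p)
    ((basis_vec b t)^T *m col j (invmx A)) 0 0 ^+ 2
    / (n%:R^-1 * \sum_(i < n)
         int01 (fun s => X i s * ((basis_vec b s)^T *m col j (invmx A)) 0 0)
           ^+ 2)).

Definition Cnp X b A (S : nat) (t : R) : R :=
  4 * alpha X b A t
  / (1 - restricted_isometry (design X b A) (2 * S)
       - restricted_orthogonality (design X b A) S (2 * S)).

End FunctionalModel.

(* Main.v *)
Require Import Defs.
From HB Require Import structures.
From mathcomp Require Import all_boot all_order all_algebra.
From mathcomp Require Import all_classical all_reals all_analysis.
From mathcomp Require Import ring lra zify.
From mathcomp Require Import finset.
Set Implicit Arguments.
Unset Strict Implicit.
Unset Printing Implicit Defensive.
Import Order.TTheory GRing.Theory Num.Theory.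
Import numFieldNormedType.Exports.
Local Open Scope ring_scope.

(** Write [V] for the design, [W] for [V] with standardized columns and
    [g_j = |V_j| gamma_j] for the rescaled true coefficients, so that
    [Y = W g + eps*] ([responseE], [normalize_cols_mul]).

    A lasso solution under the sign condition is a Dantzig selector solution
    ([lasso_is_dantzig]).  The first order conditions of the lasso make it
    feasible; with [M] the signed active columns of [W] and
    [u = (M^T M)^-1 1 >= 0], the vector [z = W^T M u], whose entries are at most
    one in absolute value, certifies that no feasible vector has a smaller l1
    norm.

    For the Dantzig selector, the condition on the noise says that [g] is
    feasible.  Hence the error [h] satisfies [|W_j^T W h| <= 2 lambda] for all
    [j], and [|h|_1] outside the support [T0] of [g] is at most [|h|_1] on [T0]
    ([l1norm_cone]).  Let [T1] carry the [S] largest entries of [h] outside [T0],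
    and [T01] be the union of [T0] and [T1].  Cutting the rest into blocks of
    decreasing entries ([shelling]) bounds both the Euclidean norm of [h] outside
    [T01] and its interaction with [h] on [T01].  Together with the restricted
    isometry on [T01] this gives, with [delta] and [theta] the restricted isometry
    and orthogonality constants,
    [(1 - delta - theta) |h_T01| <= 2 lambda sqrt (2 S)] and
    [|h| <= sqrt 2 |h_T01|] ([l2_error_bound], [dantzig_l2_error]).

    Finally the estimate minus [B(t)^T eta] is linear in [h], with a coefficient
    vector of Euclidean norm [alpha(t) / sqrt n] ([dot_rescale_le], [alphaE]),
    while [B(t)^T eta - beta(t)] is bounded by the approximation error. *)

(** * Cauchy-Schwarz for finite sums *)

Section CauchySchwarz.
Variables (R : realType) (I : finType) (P : pred I).
Implicit Types a b : I -> R.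

Lemma sum_sqr_ge0 a : 0 <= \sum_(i | P i) a i ^+ 2.
Proof. by apply: sumr_ge0 => i _; exact: sqr_ge0. Qed.

Lemma sqr_sum_mul_le a b :
  (\sum_(i | P i) a i * b i) ^+ 2
  <= (\sum_(i | P i) a i ^+ 2) * (\sum_(i | P i) b i ^+ 2).
Proof.
(* Lagrange's identity *)
have key : 0 <= \sum_(i | P i) \sum_(j | P j) (a i * b j - a j * b i) ^+ 2.
  by apply: sumr_ge0 => i _; apply: sumr_ge0 => j _; exact: sqr_ge0.
have E : \sum_(i | P i) \sum_(j | P j) (a i * b j - a j * b i) ^+ 2 =
    2 * ((\sum_(i | P i) a i ^+ 2) * (\sum_(i | P i) b i ^+ 2)
         - (\sum_(i | P i) a i * b i) ^+ 2).
  transitivity (\sum_(i | P i) \sum_(j | P j)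
      (a i ^+ 2 * b j ^+ 2 + b i ^+ 2 * a j ^+ 2 - 2 * (a i * b i * (a j * b j)))).
    by apply: eq_bigr => i _; apply: eq_bigr => j _; ring.
  under eq_bigr do rewrite big_split sumrN big_split /= -!mulr_sumr.
  by rewrite big_split sumrN big_split /= -mulr_sumr -!mulr_suml; ring.
by move: key; rewrite E pmulr_rge0 ?ltr0n // subr_ge0.
Qed.

Lemma sum_mul_le_sqrt a b :
  \sum_(i | P i) a i * b i
  <= Num.sqrt (\sum_(i | P i) a i ^+ 2) * Num.sqrt (\sum_(i | P i) b i ^+ 2).
Proof.
rewrite -sqrtrM ?sum_sqr_ge0 //.
apply: (le_trans (ler_norm _)); rewrite -sqrtr_sqr.
by apply: ler_wsqrtr; exact: sqr_sum_mul_le.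
Qed.

End CauchySchwarz.

(** * Norms restricted to a set of coordinates, and shelling *)

Section RestrictedNorms.
Variables (R : realType) (p : nat).
Implicit Types (v : 'cV[R]_p) (T U : {set 'I_p}).

(** The l1 norm of [v] over the coordinates in [T]. *)
Definition norm1_on v T : R := \sum_(j in T) `|v j 0|.

(** The Euclidean norm of [v] over the coordinates in [T]. *)
Definition norm2_on v T : R := Num.sqrt (\sum_(j in T) v j 0 ^+ 2).

(** The vector [v] with the entries outside [T] replaced by zero; the dimension
    is kept. *)
Definition restrict v T : 'cV[R]_p := \col_j (if j \in T then v j 0 else 0).

Lemma norm1_on_ge0 v T : 0 <= norm1_on v T.
Proof. by apply: sumr_ge0. Qed.

Lemma norm2_on_ge0 v T : 0 <= norm2_on v T.
Proof. exact: sqrtr_ge0. Qed.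

Lemma norm2_on_sqr v T : norm2_on v T ^+ 2 = \sum_(j in T) v j 0 ^+ 2.
Proof. by rewrite sqr_sqrtr // sum_sqr_ge0. Qed.

Lemma norm1_onT v : norm1_on v setT = l1norm v.
Proof. by rewrite /norm1_on /l1norm; apply: eq_bigl => j; rewrite inE. Qed.

Lemma norm2_onT v : norm2_on v setT = l2norm v.
Proof.
by rewrite /norm2_on /l2norm; congr Num.sqrt; apply: eq_bigl => j; rewrite inE.
Qed.

Lemma norm1_on0 v : norm1_on v set0 = 0.
Proof. by rewrite /norm1_on big_set0. Qed.

Lemma norm2_on0 v : norm2_on v set0 = 0.
Proof. by rewrite /norm2_on big_set0 sqrtr0. Qed.

Lemma norm1_onU v T U : [disjoint T & U] ->
  norm1_on v (T :|: U) = norm1_on v T + norm1_on v U.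
Proof.
by move=> dTU; rewrite /norm1_on -bigU //; apply: eq_bigl => j; rewrite !inE.
Qed.

Lemma norm2_onU v T U : [disjoint T & U] ->
  norm2_on v (T :|: U) ^+ 2 = norm2_on v T ^+ 2 + norm2_on v U ^+ 2.
Proof.
move=> dTU; rewrite !norm2_on_sqr -bigU //.
by apply: eq_bigl => j; rewrite !inE.
Qed.

Lemma norm2_onS v T U : T \subset U -> norm2_on v T <= norm2_on v U.
Proof.
move=> /setIidPr TU; apply: ler_wsqrtr.
rewrite [leRHS](big_setID T) /= TU lerDl.
by apply: sumr_ge0 => j _; exact: sqr_ge0.
Qed.

Lemma norm1_on_le_norm2 v T : norm1_on v T <= Num.sqrt #|T|%:R * norm2_on v T.
Proof.
have := sum_mul_le_sqrt (mem T) (fun _ => 1) (fun j => `|v j 0|).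
under eq_bigr do rewrite mul1r.
move=> /le_trans; apply.
rewrite le_eqVlt; apply/orP; left; apply/eqP; congr (Num.sqrt _ * Num.sqrt _).
  by rewrite (eq_bigr (fun=> 1)) ?sumr_const // => j _; rewrite expr1n.
by apply: eq_bigr => j _; rewrite real_normK // num_real.
Qed.

Lemma restrictT v : restrict v setT = v.
Proof. by apply/matrixP => i j; rewrite !mxE inE ord1. Qed.

Lemma restrictU v T U : [disjoint T & U] ->
  restrict v (T :|: U) = restrict v T + restrict v U.
Proof.
move=> dTU; apply/matrixP => i j; rewrite !mxE inE.
case: (boolP (i \in T)) => iT /=; last by rewrite add0r.
by rewrite (disjointFr dTU iT) addr0.
Qed.

(** The [S] entries of [v] on [U] that are largest in absolute value, or all of
    [U] when it has fewer than [S] elements. *)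
Lemma largest_entries v U (S : nat) :
  exists T, [/\ T \subset U, #|T| = minn S #|U|
    & forall i j, i \in T -> j \in U :\: T -> `|v j 0| <= `|v i 0|].
Proof.
elim: S => [|S [T [TU cT topT]]].
  exists set0; split; rewrite ?sub0set ?cards0 ?min0n //.
  by move=> i j; rewrite inE.
have [/eqP UT0|/set0Pn[k0 k0UT]] := boolP (U :\: T == set0).
  have TeU : T = U by apply/eqP; rewrite eqEsubset TU -setD_eq0 UT0 eqxx.
  exists U; split => //; first by rewrite TeU in cT; lia.
  move=> i j _; by rewrite setDv inE.
case: (@arg_maxP _ _ _ k0 (mem (U :\: T)) (fun k => `|v k 0|) k0UT).
move=> k kUT kmax.
have [kT kU] : k \notin T /\ k \in U.
  by have : k \in U :\: T := kUT; rewrite !inE => /andP.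
exists (k |: T); split.
- by rewrite subUset sub1set kU.
- have : (#|T| < #|U|)%N.
    apply: proper_card; rewrite properE TU /=; apply/subsetPn; by exists k.
  by rewrite cardsU1 kT cT; lia.
- move=> i j; rewrite !inE negb_or -andbA.
  case/orP => [/eqP->|iT] /and3P[jk jT jU].
    by apply: kmax; apply/setDP.
  by apply: topT; rewrite // !inE jT.
Qed.

(** Splitting off the [S] largest entries of [U] costs [K * sqrt S * M], where
    [M] bounds the entries on [U]; the entries that remain are bounded by the mean
    of those split off, so that the cost of each later block is paid for by the l1
    norm of the preceding one. *)
Lemma shelling_aux v (S : nat) (K : R) (N : {set 'I_p} -> R) :
  (0 < S)%N -> 0 <= K ->
  (forall T T', [disjoint T & T'] -> N (T :|: T') <= N T + N T') ->
  forall U, (forall T, T \subset U -> (#|T| <= S)%N -> N T <= K * norm2_on v T) ->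
  forall M, 0 <= M -> (forall j, j \in U -> `|v j 0| <= M) ->
  N U <= K * (Num.sqrt S%:R * M + norm1_on v U / Num.sqrt S%:R).
Proof.
move=> S0 K0 subN U.
have sS : 0 < Num.sqrt (S%:R : R) by rewrite sqrtr_gt0 ltr0n.
have sS2 : Num.sqrt S%:R ^+ 2 = S%:R :> R by rewrite sqr_sqrtr // ler0n.
elim: {U}#|U| {-2}U (leqnn #|U|) => [|m IH] U cU NU M M0 vM.
  have -> : U = set0 by apply/cards0_eq; lia.
  apply: (le_trans (NU _ (sub0set _) _)); rewrite ?cards0 //.
  rewrite norm2_on0 norm1_on0 mulr0 mul0r addr0 mulr_ge0 // mulr_ge0 //; exact: ltW.
have [T [TU cT topT]] := largest_entries v U S.
(* The block T has at most S entries, all bounded by M. *)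
have bT : N T <= K * (Num.sqrt S%:R * M).
  apply: (le_trans (NU _ TU _)); first by rewrite cT geq_minl.
  rewrite ler_wpM2l // -[in leRHS](ger0_norm M0) -sqrtr_sqr -sqrtrM ?ler0n //.
  apply: ler_wsqrtr; apply: (@le_trans _ _ (\sum_(j in T) M ^+ 2)).
    apply: ler_sum => j jT; rewrite -(real_normK (num_real (v j 0))).
    by rewrite lerXn2r ?nnegrE // vM // (fintype.subsetP TU).
  rewrite sumr_const -[leLHS]mulr_natl ler_wpM2r ?sqr_ge0 // ler_nat cT.
  exact: geq_minl.
have dT : [disjoint T & U :\: T] by rewrite -setI_eq0 setIDA setIC setDIl setDv setI0.
have UE : U = T :|: (U :\: T) by rewrite -{1}(setID U T) (setIidPr TU).
have [US|SU] := leqP #|U| S.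
  have TeU : T = U.
    by apply/eqP; rewrite eqEcard TU cT (minn_idPr US) leqnn.
  rewrite -{1}TeU (le_trans bT) // ler_wpM2l // lerDl divr_ge0 ?norm1_on_ge0 //.
have cTS : #|T| = S by rewrite cT (minn_idPl (ltnW SU)).
rewrite {1}UE (le_trans (subN _ _ dT)) //.
have IHU : N (U :\: T) <=
    K * (Num.sqrt S%:R * (norm1_on v T / S%:R)
         + norm1_on v (U :\: T) / Num.sqrt S%:R).
  apply: IH.
  - rewrite cardsD (setIidPr TU) cTS leq_subLR (leq_trans cU) //.
    by rewrite -add1n leq_add2r.
  - move=> T' sT' cT'; apply: NU => //.
    exact: fintype.subset_trans sT' (subsetDl _ _).
  - by rewrite divr_ge0 ?norm1_on_ge0 ?ler0n.
  - move=> j jUT; rewrite ler_pdivlMr ?ltr0n // -cTS mulr_natr -sumr_const.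
    by apply: ler_sum => i iT; apply: topT.
apply: (le_trans (lerD bT IHU)).
rewrite -mulrDr ler_wpM2l // lerD2l [in leRHS]UE norm1_onU // mulrDl lerD2r.
rewrite le_eqVlt; apply/orP; left; apply/eqP.
rewrite -{2}sS2; field; exact: lt0r_neq0.
Qed.

(** The shelling argument of Candes and Tao: after removal of the [S] largest
    entries, a set function that is subadditive on disjoint sets and bounded by the
    Euclidean norm on sets of size at most [S] is bounded by the l1 norm
    over [sqrt S], with the same factor [K].  Allowing an arbitrary [N] serves both the Euclidean norm itself and
    the inner product with a fixed vector. *)
Lemma shelling v (S : nat) (K : R) (N : {set 'I_p} -> R) U T :
  (0 < S)%N -> 0 <= K ->
  (forall T T', [disjoint T & T'] -> N (T :|: T') <= N T + N T') ->
  (forall T', T' \subset U :\: T -> (#|T'| <= S)%N -> N T' <= K * norm2_on v T') ->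
  T \subset U -> #|T| = minn S #|U| ->
  (forall i j, i \in T -> j \in U :\: T -> `|v j 0| <= `|v i 0|) ->
  N (U :\: T) <= K * (norm1_on v U / Num.sqrt S%:R).
Proof.
move=> S0 K0 subN NU TU cT topT.
have sS : 0 < Num.sqrt (S%:R : R) by rewrite sqrtr_gt0 ltr0n.
have sS2 : Num.sqrt S%:R ^+ 2 = S%:R :> R by rewrite sqr_sqrtr // ler0n.
have dT : [disjoint T & U :\: T] by rewrite -setI_eq0 setIDA setIC setDIl setDv setI0.
have UE : U = T :|: (U :\: T) by rewrite -{1}(setID U T) (setIidPr TU).
have := shelling_aux S0 K0 subN NU (M := norm1_on v T / S%:R).
rewrite divr_ge0 ?norm1_on_ge0 ?ler0n // => /(_ isT) H.
apply: (le_trans (H _)).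
  move=> j jUT; have cTS : #|T| = S.
    have : (0 < #|U :\: T|)%N by apply/card_gt0P; exists j.
    rewrite cardsD (setIidPr TU) cT subn_gt0 gtn_min ltnn orbF => SU.
    by rewrite (minn_idPl (ltnW SU)).
  rewrite ler_pdivlMr ?ltr0n // -cTS mulr_natr -sumr_const.
  by apply: ler_sum => i iT; apply: topT.
rewrite ler_wpM2l // [in leRHS]UE norm1_onU // mulrDl lerD2r.
rewrite le_eqVlt; apply/orP; left; apply/eqP.
rewrite -{2}sS2; field; exact: lt0r_neq0.
Qed.

End RestrictedNorms.

(** * The restricted isometry and orthogonality constants *)

Section RestrictedConstants.
Variable R : realType.

Lemma l2norm_ge0 m (v : 'cV[R]_m) : 0 <= l2norm v.
Proof. exact: sqrtr_ge0. Qed.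

Lemma l2norm_sqr m (v : 'cV[R]_m) : l2norm v ^+ 2 = \sum_i v i 0 ^+ 2.
Proof. by rewrite sqr_sqrtr // sum_sqr_ge0. Qed.

Lemma l2norm_eq0 m (v : 'cV[R]_m) : (l2norm v == 0) = (v == 0).
Proof.
apply/eqP/eqP => [v0|->]; last first.
  by rewrite /l2norm big1 ?sqrtr0 // => i _; rewrite mxE expr0n.
apply/matrixP => i j; rewrite ord1 mxE; apply/eqP; rewrite -sqrf_eq0.
have := l2norm_sqr v; rewrite v0 expr0n /= => /esym/eqP.
rewrite psumr_eq0; last by move=> k _; exact: sqr_ge0.
by move=> /allP/(_ i); rewrite mem_index_enum => /(_ isT).
Qed.

Lemma dotE m (u v : 'cV[R]_m) : (u^T *m v) 0 0 = \sum_i u i 0 * v i 0.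
Proof. by rewrite mxE; apply: eq_bigr => i _; rewrite mxE. Qed.

Lemma dot_self m (v : 'cV[R]_m) : (v^T *m v) 0 0 = l2norm v ^+ 2.
Proof. by rewrite dotE l2norm_sqr; apply: eq_bigr => i _; rewrite expr2. Qed.

Lemma dot_le m (u v : 'cV[R]_m) : `|(u^T *m v) 0 0| <= l2norm u * l2norm v.
Proof.
rewrite dotE /l2norm -sqrtrM ?sum_sqr_ge0 // -sqrtr_sqr.
by apply: ler_wsqrtr; exact: sqr_sum_mul_le.
Qed.

Lemma l2norm_mulmx_le n m (Z : 'M[R]_(n, m)) (c : 'cV[R]_m) :
  l2norm (Z *m c) ^+ 2 <= (\sum_i \sum_j Z i j ^+ 2) * l2norm c ^+ 2.
Proof.
rewrite !l2norm_sqr mulr_suml; apply: ler_sum => i _.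
by rewrite mxE; exact: sqr_sum_mul_le.
Qed.

Variables n p : nat.
Implicit Types (Z : 'M[R]_(n, p)) (T : {set 'I_p}) (h : 'cV[R]_p).

Lemma std_cols_frobenius_le Z T :
  \sum_i \sum_j std_cols Z T i j ^+ 2
  <= \sum_i \sum_j normalize_cols Z i j ^+ 2.
Proof.
apply: ler_sum => i _.
under eq_bigr do rewrite mxE.
rewrite -(big_enum_val (fun j => normalize_cols Z i j ^+ 2)) /=.
rewrite [leRHS](bigID (mem T)) /= lerDl.
by apply: sumr_ge0 => j _; exact: sqr_ge0.
Qed.

Lemma std_cols_le Z T c :
  l2norm (std_cols Z T *m c) ^+ 2
  <= (\sum_i \sum_j normalize_cols Z i j ^+ 2) * l2norm c ^+ 2.
Proof.
apply: (le_trans (l2norm_mulmx_le _ _)); apply: ler_wpM2r; first exact: sqr_ge0.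
exact: std_cols_frobenius_le.
Qed.

(** Extracting columns and zeroing coordinates are interchangeable, which removes
    the dependent dimension [#|T|]. *)
Lemma std_cols_mul Z T h :
  std_cols Z T *m (\col_k h (enum_val k) 0) = normalize_cols Z *m restrict h T.
Proof.
apply/matrixP => i j; rewrite ord1 !mxE.
under eq_bigr => k _ do rewrite !mxE.
rewrite -(big_enum_val (fun j => Z i j / l2norm (col j Z) * h j 0)) /=.
rewrite big_mkcond; apply: eq_bigr => k _; rewrite !mxE.
by case: ifP => _; rewrite ?mulr0.
Qed.

Lemma l2norm_enum_val h T : l2norm (\col_k h (enum_val k) 0 : 'cV_#|T|) = norm2_on h T.
Proof.
rewrite /l2norm /norm2_on; congr Num.sqrt.
under eq_bigr => k _ do rewrite mxE.
by rewrite -(big_enum_val (fun j => h j 0 ^+ 2)).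
Qed.

(** The infimum defining the restricted isometry constant satisfies the lower
    inequality of its defining set. *)
Lemma restricted_isometryP Z (S : nat) h T : (#|T| <= S)%N ->
  (1 - restricted_isometry Z S) * norm2_on h T ^+ 2
  <= l2norm (normalize_cols Z *m restrict h T) ^+ 2.
Proof.
move=> TS.
have [h0|h0] := eqVneq (norm2_on h T) 0; first by rewrite h0 expr0n mulr0 sqr_ge0.
have hgt0 : 0 < norm2_on h T ^+ 2 by rewrite exprn_gt0 // lt0r h0 norm2_on_ge0.
rewrite -ler_pdivlMr // lerBlDr -lerBlDl.
set K := \sum_i \sum_j normalize_cols Z i j ^+ 2.
have K0 : 0 <= K by apply: sumr_ge0 => i _; exact: sum_sqr_ge0.
apply: lb_le_inf.
  (* The squared Frobenius norm K shows that admissible constants exist. *)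
  exists (1 + K) => T' c cT'; split.
    apply: (@le_trans _ _ 0); last exact: sqr_ge0.
    by rewrite mulr_le0_ge0 ?sqr_ge0 // opprD addrA subrr sub0r oppr_le0.
  apply: (le_trans (std_cols_le _ _)); rewrite ler_wpM2r ?sqr_ge0 //.
  by rewrite -/K; lra.
move=> d /(_ T (\col_k h (enum_val k) 0) TS) [+ _].
by rewrite std_cols_mul l2norm_enum_val -ler_pdivlMr // lerBlDr lerBlDl.
Qed.

(** The infimum defining the restricted orthogonality constant is itself
    admissible. *)
Lemma restricted_orthogonalityP Z (S S' : nat) h h' T T' :
  [disjoint T & T'] -> (#|T| <= S)%N -> (#|T'| <= S')%N ->
  `|((normalize_cols Z *m restrict h T)^T
       *m (normalize_cols Z *m restrict h' T')) 0 0|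
  <= restricted_orthogonality Z S S' * norm2_on h T * norm2_on h' T'.
Proof.
move=> dTT TS TS'; rewrite -!std_cols_mul -!l2norm_enum_val.
set c := \col_k h _ _; set c' := \col_k h' _ _.
have [/eqP|c0] := eqVneq (l2norm c) 0.
  by rewrite l2norm_eq0 => /eqP ->; rewrite mulmx0 trmx0 mul0mx mxE normr0
    (eqP (_ : l2norm 0 == 0)) ?l2norm_eq0 // mulr0 mul0r.
have [/eqP|c'0] := eqVneq (l2norm c') 0.
  by rewrite l2norm_eq0 => /eqP ->; rewrite !mulmx0 mxE normr0
    (eqP (_ : l2norm 0 == 0)) ?l2norm_eq0 // mulr0.
have cgt0 : 0 < l2norm c * l2norm c'.
  by rewrite mulr_gt0 // lt0r l2norm_ge0 ?c0 ?c'0.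
rewrite -mulrA -ler_pdivrMr //.
set K := \sum_i \sum_j normalize_cols Z i j ^+ 2.
have K0 : 0 <= K by apply: sumr_ge0 => i _; exact: sum_sqr_ge0.
apply: lb_le_inf; last first.
  by move=> th /(_ T T' c c' dTT TS TS'); rewrite ler_pdivrMr // mulrA.
(* K is an admissible constant. *)
exists K => U U' d d' _ _ _; apply: (le_trans (dot_le _ _)).
have sK V e : l2norm (std_cols Z V *m e) <= Num.sqrt K * l2norm e.
  rewrite -(ler_pXn2r (ltn0Sn 1)) ?nnegrE ?mulr_ge0 ?l2norm_ge0 ?sqrtr_ge0 //.
  by rewrite exprMn (sqr_sqrtr K0); exact: std_cols_le.
rewrite -{1}(sqr_sqrtr K0) expr2 -!mulrA (mulrCA _ (l2norm d)) (mulrA _ (l2norm d)).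
by apply: ler_pM; rewrite ?l2norm_ge0 ?sK.
Qed.

Lemma restricted_orthogonality_ge0 Z (S S' : nat) :
  0 <= restricted_orthogonality Z S S'.
Proof.
rewrite /restricted_orthogonality; set E := (X in inf X).
have [infE|ninfE] := pselect (has_inf E); last by rewrite inf_out.
apply: lb_le_inf; first by case: infE.
move=> th Eth; rewrite leNgt; apply/negP => th0.
(* A negative admissible bound would make every bound admissible. *)
case: infE => _ [m lbm].
suff Em : E (m - 1) by have := lbm _ Em; lra.
move=> T T' c c' dTT TS TS'.
have := Eth _ _ c c' dTT TS TS'.
have : 0 <= l2norm c * l2norm c' by rewrite mulr_ge0 ?l2norm_ge0.
rewrite -!mulrA le_eqVlt => /orP[/eqP <-|cc]; first by rewrite !mulr0.
move=> /(le_trans (normr_ge0 _)); rewrite leNgt nmulr_rlt0 ?cc //.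
Qed.

End RestrictedConstants.

(** * The Euclidean error bound *)

Section ErrorBound.
Variables (R : realType) (n p : nat).
Implicit Types (W : 'M[R]_(n, p)) (g h : 'cV[R]_p) (T : {set 'I_p}).

Lemma norm2_on_subadd h T T' : [disjoint T & T'] ->
  norm2_on h (T :|: T') <= norm2_on h T + norm2_on h T'.
Proof.
move=> dTT; rewrite -(ler_pXn2r (ltn0Sn 1)) ?nnegrE ?addr_ge0 ?norm2_on_ge0 //.
rewrite norm2_onU // sqrrD lerD2r lerDl mulrn_wge0 // mulr_ge0 //; exact: norm2_on_ge0.
Qed.

(** If adding [h] to [g] does not increase the l1 norm, then at least half of the
    l1 norm of [h] lies on the support of [g]. *)
Lemma l1norm_cone g h : l1norm (g + h) <= l1norm g ->
  norm1_on h (~: [set j | g j 0 != 0]) <= norm1_on h [set j | g j 0 != 0].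
Proof.
set T := [set j | _] => gh.
have splitl v : l1norm v = norm1_on v T + norm1_on v (~: T).
  rewrite -norm1_onT -(setUCr T) norm1_onU // -setI_eq0 setICr //.
have gC : norm1_on g (~: T) = 0.
  rewrite /norm1_on big1 // => j; rewrite !inE negbK => /eqP ->; exact: normr0.
have ghC : norm1_on (g + h) (~: T) = norm1_on h (~: T).
  by apply: eq_bigr => j; rewrite !inE negbK mxE => /eqP ->; rewrite add0r.
have ghT : norm1_on g T - norm1_on h T <= norm1_on (g + h) T.
  rewrite /norm1_on -sumrB; apply: ler_sum => j _; rewrite mxE.
  exact: lerB_normD.
by move: gh; rewrite !splitl gC ghC; lra.
Qed.

Lemma dot_restrict_le W h T (u : 'cV[R]_n) (m : R) :
  (forall j, `|((col j W)^T *m u) 0 0| <= m) ->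
  `|((W *m restrict h T)^T *m u) 0 0| <= norm1_on h T * m.
Proof.
move=> Wu.
have -> : ((W *m restrict h T)^T *m u) 0 0
    = \sum_(j in T) h j 0 * ((col j W)^T *m u) 0 0.
  rewrite trmx_mul -mulmxA mxE [RHS]big_mkcond; apply: eq_bigr => j _.
  rewrite !mxE; case: ifP => _; last by rewrite mul0r.
  by congr (_ * _); apply: eq_bigr => i _; rewrite !mxE.
apply: (le_trans (ler_norm_sum _ _ _)); rewrite mulr_suml.
by apply: ler_sum => j _; rewrite normrM ler_wpM2l.
Qed.

(** The Candes-Tao bound, for a vector [h] such that [g + h] has no larger l1 norm
    than the sparse vector [g] and whose correlations [W_j^T W h] are small, [W]
    being [normalize_cols Z]. *)
Lemma l2_error_bound (Z : 'M[R]_(n, p)) (S : nat) (lambda : R) g h :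
  0 <= lambda ->
  (#|[set j | g j ord0 != 0%R]| <= S)%N ->
  restricted_isometry Z (2 * S) + restricted_orthogonality Z S (2 * S) < 1 ->
  l1norm (g + h) <= l1norm g ->
  (forall j, `|((col j (normalize_cols Z))^T *m (normalize_cols Z *m h)) 0 0|
             <= 2 * lambda) ->
  l2norm h <= 4 * lambda * Num.sqrt S%:R
    / (1 - restricted_isometry Z (2 * S) - restricted_orthogonality Z S (2 * S)).
Proof.
move=> lambda0 gS uup /l1norm_cone + corr.
set T0 := [set j | _] in gS * => cone.
set W := normalize_cols Z in corr *.
set delta := restricted_isometry _ _ in uup *.
set theta := restricted_orthogonality _ _ _ in uup *.
have D0 : 0 < 1 - delta - theta by lra.
have theta0 : 0 <= theta by exact: restricted_orthogonality_ge0.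
(* For S = 0 the vector g is zero, and then so is h. *)
have [S0|S0] := posnP S.
  have T00 : T0 = set0 by apply/cards0_eq; lia.
  suff -> : h = 0.
    rewrite (eqP (_ : l2norm 0 == 0)) ?l2norm_eq0 //.
    by rewrite divr_ge0 ?(ltW D0) // mulr_ge0 ?sqrtr_ge0 // mulr_ge0.
  move: cone; rewrite T00 setC0 norm1_on0 => h0.
  apply/matrixP => i j; rewrite ord1 mxE; apply/eqP; rewrite -normr_le0.
  apply: le_trans h0; rewrite /norm1_on (bigD1 i) ?inE //= lerDl.
  exact: sumr_ge0.
have sS : 0 < Num.sqrt (S%:R : R) by rewrite sqrtr_gt0 ltr0n.
have [T1 [T1C cT1 topT1]] := largest_entries h (~: T0) S.
have dT01 : [disjoint T0 & T1] by rewrite disjoint_sym disjoints_subset.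
set T01 := T0 :|: T1; set Tc := ~: T0 :\: T1.
have cT01 : (#|T01| <= 2 * S)%N.
  apply: (leq_trans (leq_card_setU _ _)); rewrite mul2n -addnn leq_add //.
  by rewrite cT1 geq_minl.
have TcE : Tc = ~: T01 by rewrite /Tc /T01 setCU setDE.
have dTc : [disjoint T01 & Tc] by rewrite TcE -setI_eq0 setICr.
have hE : h = restrict h T01 + restrict h Tc.
  by rewrite -restrictU // TcE setUCr restrictT.
set a := norm2_on h T01.
have a0 : 0 <= a := norm2_on_ge0 _ _.
(* The l1 norm outside T0, over sqrt S, is the bound that shelling provides. *)
have tail : norm1_on h (~: T0) / Num.sqrt S%:R <= a.
  rewrite ler_pdivrMr // (le_trans cone) //.
  apply: (le_trans (norm1_on_le_norm2 _ _)); rewrite mulrC.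
  apply: ler_pM; rewrite ?norm2_on_ge0 ?sqrtr_ge0 //.
    by apply: norm2_onS; exact: subsetUl.
  by apply: ler_wsqrtr; rewrite ler_nat.
have tail2 : norm2_on h Tc <= a.
  apply: le_trans tail; rewrite -[leRHS]mul1r.
  apply: (@shelling _ _ h S 1 (norm2_on h) (~: T0) T1) => //.
  - exact: norm2_on_subadd.
  - by move=> T' _ _; rewrite mul1r.
have cross : `|((W *m restrict h Tc)^T *m (W *m restrict h T01)) 0 0|
    <= theta * a * a.
  apply: (@le_trans _ _ (theta * a * (norm1_on h (~: T0) / Num.sqrt S%:R)));
    last first.
    by rewrite ler_wpM2l // mulr_ge0.
  apply: (@shelling _ _ h S (theta * a)
    (fun T => `|((W *m restrict h T)^T *m (W *m restrict h T01)) 0 0|)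
    (~: T0) T1) => //.
  - exact: mulr_ge0.
  - move=> T T' dTT; rewrite restrictU // mulmxDr linearD mulmxDl mxE.
    exact: ler_normD.
  - move=> T' T'c cT'; rewrite mulrAC.
    apply: restricted_orthogonalityP => //.
    by rewrite disjoint_sym; apply: disjointWr dTc.
have main : `|((W *m restrict h T01)^T *m (W *m h)) 0 0|
    <= Num.sqrt (2 * S%:R) * a * (2 * lambda).
  apply: (le_trans (dot_restrict_le _ _ corr)).
  rewrite ler_wpM2r ?mulr_ge0 //; apply: (le_trans (norm1_on_le_norm2 _ _)).
  by rewrite ler_wpM2r //; apply: ler_wsqrtr; rewrite -natrM ler_nat.
have lower := restricted_isometryP Z h cT01.
have expand : l2norm (W *m restrict h T01) ^+ 2
   = ((W *m restrict h T01)^T *m (W *m h)) 0 0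
     - ((W *m restrict h Tc)^T *m (W *m restrict h T01)) 0 0.
  have -> : W *m h = W *m restrict h T01 + W *m restrict h Tc.
    by rewrite {1}hE mulmxDr.
  rewrite mulmxDr mxE dot_self !dotE.
  rewrite -addrA -[LHS]addr0; congr (_ + _).
  by apply/esym/eqP; rewrite subr_eq0; apply/eqP; apply: eq_bigr => i _; rewrite mulrC.
rewrite -/W -/delta -/a expand in lower.
have bound_a : (1 - delta - theta) * a <= Num.sqrt (2 * S%:R) * (2 * lambda).
  have [->|an0] := eqVneq a 0.
    by rewrite mulr0 mulr_ge0 ?sqrtr_ge0 // mulr_ge0.
  have agt0 : 0 < a by rewrite lt0r an0.
  rewrite -(ler_pM2r agt0).
  move: (ler_norm (((W *m restrict h T01)^T *m (W *m h)) 0 0)).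
  move: (ler_norm (- ((W *m restrict h Tc)^T *m (W *m restrict h T01)) 0 0)).
  rewrite normrN; move: main cross lower; rewrite expr2; lra.
have bound_h : l2norm h <= Num.sqrt 2 * a.
  rewrite -(ler_pXn2r (ltn0Sn 1)) ?nnegrE ?mulr_ge0 ?l2norm_ge0 ?sqrtr_ge0 //.
  rewrite -norm2_onT -(setUCr T01) -TcE norm2_onU // exprMn (sqr_sqrtr (ler0n _ 2)).
  have : norm2_on h Tc ^+ 2 <= a ^+ 2 by rewrite lerXn2r ?nnegrE ?norm2_on_ge0.
  by rewrite -/a; lra.
rewrite ler_pdivlMr //; apply: (le_trans (ler_wpM2r (ltW D0) bound_h)).
rewrite -[leLHS]mulrA (mulrC a).
apply: (le_trans (ler_wpM2l (sqrtr_ge0 _) bound_a)).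
rewrite sqrtrM // !mulrA -expr2 (sqr_sqrtr (ler0n _ 2)).
by rewrite le_eqVlt; apply/orP; left; apply/eqP; ring.
Qed.

(** Estimation error of the Dantzig selector when the sparse vector [g] is feasible:
    no linear model for [Y] is needed. *)
Lemma dantzig_l2_error (Z : 'M[R]_(n, p)) (S : nat) (lambda : R)
    (Y : 'cV[R]_n) (g ghat : 'cV[R]_p) :
  0 <= lambda ->
  (#|[set j | g j ord0 != 0%R]| <= S)%N ->
  restricted_isometry Z (2 * S) + restricted_orthogonality Z S (2 * S) < 1 ->
  dantzig_feasible Y (normalize_cols Z) lambda g ->
  dantzig_solution Y (normalize_cols Z) lambda ghat ->
  l2norm (ghat - g) <= 4 * lambda * Num.sqrt S%:R
    / (1 - restricted_isometry Z (2 * S) - restricted_orthogonality Z S (2 * S)).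
Proof.
move=> lambda0 gS uup gf [ghatf ghatmin].
apply: (@l2_error_bound Z S lambda g) => //.
  by rewrite addrC subrK; exact: ghatmin.
move=> j; set W := normalize_cols Z in gf ghatf *.
have -> : W *m (ghat - g) = (Y - W *m g) - (Y - W *m ghat).
  by rewrite mulmxBr opprD addrACA subrr add0r opprK addrC.
rewrite mulmxBr mxE [X in _ + X]mxE (le_trans (ler_normB _ _)) //.
by rewrite mulr2n mulrDl !mul1r lerD // ?gf ?ghatf.
Qed.

End ErrorBound.

(** * Lasso solutions that solve the Dantzig selector problem *)

Section LassoIsDantzig.
Variables (R : realType) (n p : nat).
Implicit Types (Y : 'cV[R]_n) (W : 'M[R]_(n, p)) (g : 'cV[R]_p).

Lemma mx_norm_coord m q (A : 'M[R]_(m, q)) i j : `|A i j| <= mx_norm A.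
Proof.
by rewrite mx_normrE; exact: (le_bigmax _ (fun ij => `|A ij.1 ij.2|) (i, j)).
Qed.

(** A linear term dominated by a quadratic one near zero on the right has
    nonpositive slope. *)
Lemma slope_le0 (a w m : R) : 0 < m -> 0 <= w ->
  (forall s, 0 < s <= m -> a * s <= w * s ^+ 2) -> a <= 0.
Proof.
move=> m0 w0 aw; rewrite leNgt; apply/negP => a0.
have w1 : 0 < w + 1 by lra.
pose s := Num.min m (a / (w + 1)).
have s0 : 0 < s by rewrite lt_min m0 divr_gt0.
have := aw s; rewrite s0 ge_min lexx => /(_ isT).
rewrite expr2 mulrA ler_pM2r // leNgt => /negP; apply.
have sw : s * (w + 1) <= a by rewrite -ler_pdivlMr // ge_min lexx orbT.
by apply: lt_le_trans sw; rewrite mulrDr mulr1 mulrC ltrDl.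
Qed.

(** Optimality of [g] against a move by [s] along the coordinate [j]. *)
Lemma lasso_coordinate_move Y W lambda g j (s : R) :
  lasso_solution Y W lambda g ->
  s * ((col j W)^T *m (Y - W *m g)) 0 0
  <= 2^-1 * s ^+ 2 * l2norm (col j W) ^+ 2
     + lambda * (`|g j 0 + s| - `|g j 0|).
Proof.
move=> /(_ (g + s *: delta_mx j 0)); rewrite /lasso_objective.
have -> : l1norm (g + s *: delta_mx j 0) = l1norm g + (`|g j 0 + s| - `|g j 0|).
  rewrite /l1norm (bigD1 j) //= [in RHS](bigD1 j) //= !mxE !eqxx mulr1.
  rewrite (eq_bigr (fun i => `|g i 0|)); first by ring.
  by move=> i ij; rewrite !mxE (negbTE ij) mulr0 addr0.
have -> : Y - W *m (g + s *: delta_mx j 0) = (Y - W *m g) - s *: col j W.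
  by rewrite mulmxDr -scalemxAr -colE opprD addrA.
move: (Y - W *m g) => r.
have -> : l2norm (r - s *: col j W) ^+ 2
    = l2norm r ^+ 2 - 2 * s * ((col j W)^T *m r) 0 0
      + s ^+ 2 * l2norm (col j W) ^+ 2.
  rewrite !l2norm_sqr dotE !mulr_sumr -sumrN -!big_split /=.
  by apply: eq_bigr => i _; rewrite !mxE; ring.
lra.
Qed.

(** The first order optimality conditions of the lasso. *)
Lemma lasso_kkt Y W lambda g j : 0 <= lambda -> lasso_solution Y W lambda g ->
  `|((col j W)^T *m (Y - W *m g)) 0 0| <= lambda
  /\ (g j 0 != 0 ->
      Num.sg (g j 0) * ((col j W)^T *m (Y - W *m g)) 0 0 = lambda).
Proof.
move=> lambda0 sol.
have mv s := lasso_coordinate_move j s sol.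
set r := ((col j W)^T *m _) 0 0 in mv *.
set w := l2norm _ ^+ 2 in mv.
have w0 : 0 <= w by exact: sqr_ge0.
have w20 : 0 <= 2^-1 * w by rewrite mulr_ge0.
have tri s : lambda * (`|g j 0 + s| - `|g j 0|) <= lambda * `|s|.
  by rewrite ler_wpM2l // lerBlDl ler_normD.
have rle : `|r| <= lambda.
  rewrite ler_norml; apply/andP; split.
    rewrite -subr_le0; apply: (slope_le0 ltr01 w20) => s /andP[s0 _].
    by have := mv (- s); have := tri (- s); rewrite normrN (gtr0_norm s0) sqrrN; lra.
  rewrite -subr_le0; apply: (slope_le0 ltr01 w20) => s /andP[s0 _].
  by have := mv s; have := tri s; rewrite (gtr0_norm s0); lra.
split=> // g0.
have sg1 : `|Num.sg (g j 0)| = 1 by rewrite normr_sg g0.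
apply/eqP; rewrite eq_le; apply/andP; split.
  apply: (le_trans (ler_norm _)); by rewrite normrM sg1 mul1r.
(* Moving g j towards zero, by at most its absolute value, lowers the l1 norm by
   the size of the step. *)
have gm : 0 < `|g j 0| by rewrite normr_gt0.
rewrite -subr_le0; apply: (slope_le0 gm w20) => s /andP[s0 sg].
have := mv (- (s * Num.sg (g j 0))).
have -> : `|g j 0 + - (s * Num.sg (g j 0))| = `|g j 0| - s.
  rewrite {1}[g j 0]numEsg mulrC -mulrBl normrM sg1 mulr1 ger0_norm //.
  by rewrite subr_ge0.
rewrite sqrrN exprMn sqr_sg g0 mulr1; lra.
Qed.

Lemma mem_active g j : (j \in active g) = (g j 0 != 0).
Proof. by rewrite inE !mxE eqxx mulr1n sgr_eq0. Qed.

Lemma signed_activeE W g i k :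
  signed_active W g i k = W i (enum_val k) * Num.sg (g (enum_val k) 0).
Proof. by rewrite /signed_active /extract_cols /sign_mx mul_mx_diag !mxE. Qed.

Lemma signed_active_dot W g (r : 'cV[R]_n) k :
  ((signed_active W g)^T *m r) k 0
  = Num.sg (g (enum_val k) 0) * ((col (enum_val k) W)^T *m r) 0 0.
Proof.
rewrite !mxE mulr_sumr; apply: eq_bigr => i _.
by rewrite mxE signed_activeE !mxE; ring.
Qed.

(** The signs are absorbed in the columns, and the inactive coordinates of [g]
    vanish. *)
Lemma signed_active_abs W g :
  signed_active W g *m (\col_k `|g (enum_val k) 0|) = W *m g.
Proof.
apply/matrixP => i j; rewrite ord1 !mxE.
under eq_bigr => k _ do rewrite signed_activeE mxE -mulrA -numEsg.
rewrite -(big_enum_val (fun j => W i j * g j 0)) /= big_mkcond /=.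
apply: eq_bigr => k _; rewrite mem_active.
by case: eqVneq => //= ->; rewrite mulr0.
Qed.

(** The sign condition provides the dual certificate [z = W^T *m M *m u], where [M]
    is [signed_active W g]: it has sup norm at most one, it pairs with [g] to the l1
    norm of [g], and nonnegativity of [u] makes its pairing with any feasible vector
    at least as large. *)
Lemma lasso_is_dantzig Y W lambda g : 0 <= lambda ->
  lasso_solution Y W lambda g -> lasso_sign_condition W g ->
  dantzig_solution Y W lambda g.
Proof.
move=> lambda0 sol; rewrite /lasso_sign_condition.
set M := signed_active W g; set u := invmx _ *m _.
move=> [MMu u0 z1]; split => [j|g' g'f].
  by have [] := lasso_kkt j lambda0 sol.
set z := W^T *m M *m u in z1.
have Mu1 : M^T *m M *m u = const_mx 1 by rewrite /u mulmxA mulmxV // mul1mx.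
have zW (v : 'cV[R]_p) : (z^T *m v) 0 0 = (u^T *m (M^T *m (W *m v))) 0 0.
  by rewrite /z !trmx_mul trmxK !mulmxA.
have zg : (z^T *m g) 0 0 = l1norm g.
  rewrite zW -signed_active_abs -/M (mulmxA M^T) mulmxA.
  have -> : u^T *m (M^T *m M) = (const_mx 1)^T.
    by rewrite -Mu1 !trmx_mul trmxK mulmxA.
  rewrite dotE; under eq_bigr do rewrite !mxE mul1r.
  rewrite -(big_enum_val (fun j => `|g j 0|)) /= big_mkcond /=.
  apply: eq_bigr => k _; rewrite mem_active.
  by case: eqVneq => //= ->; rewrite normr0.
have zg' : (z^T *m g') 0 0 <= l1norm g'.
  rewrite dotE; apply: ler_sum => j _; apply: (le_trans (ler_norm _)).
  rewrite normrM ler_piMl //; exact: le_trans (mx_norm_coord _ _ _) z1.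
apply: le_trans zg'; rewrite -zg -subr_le0.
have -> : (z^T *m g) 0 0 - (z^T *m g') 0 0
    = (u^T *m (M^T *m (Y - W *m g') - M^T *m (Y - W *m g))) 0 0.
  rewrite !zW -mulmxBr opprD addrACA subrr add0r opprK (addrC (- _)).
  by rewrite mulmxBr mulmxBr [RHS]mxE [X in _ = _ + X]mxE.
rewrite dotE; apply: sumr_le0 => k _.
apply: mulr_ge0_le0; first exact: u0.
rewrite mxE [X in _ + X]mxE !signed_active_dot.
have gk : g (enum_val k) 0 != 0 by rewrite -mem_active enum_valP.
have [_ /(_ gk) ->] := lasso_kkt (enum_val k) lambda0 sol.
rewrite subr_le0 (le_trans (ler_norm _)) // normrM normr_sg gk mul1r.
exact: g'f.
Qed.

End LassoIsDantzig.

(** * The functional model *)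

Section Model.
Variables (R : realType) (n p : nat).
Implicit Types (X : 'I_n -> R -> R) (b : 'I_p -> R -> R) (A : 'M[R]_p).

Lemma integrable01_lincomb (I : Type) (r : seq I) (f : I -> R -> R) (c : I -> R) :
  (forall j, integrable01 (f j)) ->
  integrable01 (fun t => \sum_(j <- r) f j t * c j).
Proof.
move=> intf; rewrite /integrable01.
have -> : EFin \o (fun t => \sum_(j <- r) f j t * c j)
    = (fun t => (\sum_(j <- r) ((c j)%:E * (f j t)%:E))%E).
  apply/funext => t /=; rewrite -sumEFin; apply: eq_bigr => j _.
  by rewrite -EFinM mulrC.
apply: integrable_sum => // j _.
by apply: integrableZl => //; exact: intf.
Qed.

Lemma int01_lincomb (I : Type) (r : seq I) (f : I -> R -> R) (c : I -> R) :
  (forall j, integrable01 (f j)) ->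
  int01 (fun t => \sum_(j <- r) f j t * c j) = \sum_(j <- r) int01 (f j) * c j.
Proof.
move=> intf; elim: r => [|j r IH].
  rewrite big_nil /int01 (_ : (fun _ => _) = cst 0); last first.
    by apply/funext => t; rewrite big_nil.
  by rewrite Rintegral_cst // mul0r.
rewrite big_cons -IH.
have -> : (fun t => \sum_(i <- j :: r) f i t * c i)
    = (fun t => f j t * c j + \sum_(i <- r) f i t * c i).
  by apply/funext => t; rewrite big_cons.
rewrite [LHS]RintegralD //; last exact: integrable01_lincomb.
  by congr (_ + _); rewrite RintegralZr //; exact: intf.
have := integrable01_lincomb [:: j] c intf.
by congr (integrable _ _ _); apply/funext => t /=; rewrite big_seq1.
Qed.

Lemma designE X b A i j :
  (forall i j, integrable01 (fun t => X i t * b j t)) ->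
  design X b A i j
  = int01 (fun s => X i s * ((basis_vec b s)^T *m col j (invmx A)) 0 0).
Proof.
move=> int_Xb.
rewrite mxE; under eq_bigr do rewrite mxE.
rewrite -(int01_lincomb _ (fun k => invmx A k j) (int_Xb i)).
congr int01; apply/funext => s; rewrite mxE mulr_sumr; apply: eq_bigr => k _.
by rewrite !mxE mulrA.
Qed.

(** The denominators in [alpha] are, up to the factor [1 / n], the squared column
    norms of the design. *)
Lemma col_design_sqr X b A j :
  (forall i j, integrable01 (fun t => X i t * b j t)) ->
  l2norm (col j (design X b A)) ^+ 2
  = \sum_i int01 (fun s => X i s * ((basis_vec b s)^T *m col j (invmx A)) 0 0)
      ^+ 2.
Proof.
by move=> intX; rewrite l2norm_sqr; apply: eq_bigr => i _; rewrite mxE designE.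
Qed.

(** The response is linear in the coefficients [A *m eta], with the approximation
    error absorbed in the noise. *)
Lemma responseE X b A (beta : R -> R) (eps : 'cV[R]_n) (eta : 'cV[R]_p) :
  A \in unitmx ->
  (forall i, integrable01 (fun t => X i t * beta t)) ->
  (forall i j, integrable01 (fun t => X i t * b j t)) ->
  response X beta eps
  = design X b A *m (A *m eta) + eps_star X b beta eps eta.
Proof.
move=> Au int_Xbeta int_Xb.
rewrite /design -mulmxA (mulmxA (invmx A)) mulVmx // mul1mx.
apply/matrixP => i k; rewrite ord1 !mxE.
under eq_bigr do rewrite mxE.
rewrite -(int01_lincomb _ (fun j => eta j 0) (int_Xb i)).
have -> : (fun t => X i t * basis_error b beta eta t)
    = (fun t => X i t * beta t - \sum_j X i t * b j t * eta j 0).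
  apply/funext => t; rewrite /basis_error mulrBr mxE mulr_sumr.
  by congr (_ - _); apply: eq_bigr => j _; rewrite !mxE mulrA.
rewrite [X in _ = _ + (_ + X)](_ : _ = int01 (fun t => X i t * beta t)
    - int01 (fun t => \sum_j X i t * b j t * eta j 0)); first by ring.
apply: RintegralB => //; first exact: int_Xbeta.
exact: (integrable01_lincomb _ (fun j => eta j 0) (int_Xb i)).
Qed.

Lemma normalize_cols_mul (V : 'M[R]_(n, p)) (c : 'cV[R]_p) :
  (forall j, col j V != 0) ->
  normalize_cols V *m (\col_j (l2norm (col j V) * c j 0)) = V *m c.
Proof.
move=> V0; apply/matrixP => i j; rewrite ord1 !mxE; apply: eq_bigr => k _.
by rewrite !mxE mulrA divfK // l2norm_eq0.
Qed.

(** The division by the column norms is moved from [h] to the covector [w] before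
    Cauchy-Schwarz is applied. *)
Lemma dot_rescale_le (V : 'M[R]_(n, p)) (w : 'rV[R]_p) (h : 'cV[R]_p) :
  `|(w *m rescale V h) 0 0|
  <= Num.sqrt (\sum_j (w 0 j / l2norm (col j V)) ^+ 2) * l2norm h.
Proof.
have -> : (w *m rescale V h) 0 0
    = ((\col_j (w 0 j / l2norm (col j V)))^T *m h) 0 0.
  by rewrite !mxE; apply: eq_bigr => j _; rewrite !mxE mulrAC mulrA.
apply: (le_trans (dot_le _ _)); rewrite le_eqVlt; apply/orP; left; apply/eqP.
by congr (Num.sqrt _ * _); apply: eq_bigr => j _; rewrite mxE.
Qed.

Lemma alphaE X b A (t : R) : (0 < n)%N ->
  (forall i j, integrable01 (fun t => X i t * b j t)) ->
  alpha X b A t = Num.sqrt n%:R * Num.sqrt (\sum_j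
    (((basis_vec b t)^T *m invmx A) 0 j / l2norm (col j (design X b A))) ^+ 2).
Proof.
move=> n0 intX; rewrite /alpha -sqrtrM // mulr_sumr; congr Num.sqrt.
apply: eq_bigr => j _; rewrite -col_design_sqr //.
have -> : ((basis_vec b t)^T *m col j (invmx A)) 0 0
    = ((basis_vec b t)^T *m invmx A) 0 j.
  by rewrite !mxE; apply: eq_bigr => k _; rewrite !mxE.
by rewrite expr_div_n invfM invrK; ring.
Qed.

End Model.

Theorem theorem1 (R : realType) (n p : nat) (n_gt0 : (0 < n)%N) (p_gt0 : (0 < p)%N)
  (X : 'I_n -> R -> R) (beta : R -> R) (eps : 'cV[R]_n)
  (b : 'I_p -> R -> R) (b_basis : basis01 b)
  (int_Xbeta : forall i, integrable01 (fun t => X i t * beta t))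
  (int_Xb : forall i j, integrable01 (fun t => X i t * b j t))
  (eta : 'cV[R]_p) (A : 'M[R]_p) (A_unit : A \in unitmx)
  (V_neq0 : forall j : 'I_p, col j (design X b A) != 0)
  (Sp : nat)
  (sparse : (#|[set j : 'I_p | (A *m eta) j ord0 != 0%R]| <= Sp)%N)
  (uup : restricted_isometry (design X b A) (2 * Sp)
         + restricted_orthogonality (design X b A) Sp (2 * Sp) < 1)
  (lambda : R) (lambda_ge0 : 0 <= lambda)
  (noise : mx_norm ((normalize_cols (design X b A))^T
                    *m eps_star X b beta eps eta) <= lambda)
  (ghat : 'cV[R]_p)
  (estimator :
     dantzig_solution (response X beta eps) (normalize_cols (design X b A))
       lambda ghat
     \/ (lasso_solution (response X beta eps) (normalize_cols (design X b A))
           lambda ghat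
         /\ lasso_sign_condition (normalize_cols (design X b A)) ghat)) :
  forall t : R, 0 <= t <= 1 ->
    ((`|flirti b A (rescale (design X b A) ghat) t - beta t|)%:E
     <= ((Num.sqrt n%:R)^-1 * Cnp X b A Sp t * lambda * Num.sqrt Sp%:R)%:E
        + sup_error b beta eta)%E.
Proof.
move=> t t01.
have dantzig : dantzig_solution (response X beta eps)
    (normalize_cols (design X b A)) lambda ghat.
  by case: estimator => // -[sol cond]; exact: lasso_is_dantzig.
set V := design X b A in V_neq0 uup noise dantzig *.
have respE : response X beta eps = V *m (A *m eta) + eps_star X b beta eps eta.
  exact: responseE.
pose g : 'cV[R]_p := \col_j (l2norm (col j V) * (A *m eta) j 0).
have g_sparse : (#|[set j | g j ord0 != 0%R]| <= Sp)%N.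
  apply: leq_trans sparse; apply/subset_leq_card/fintype.subsetP => j.
  by rewrite !inE [g _ _]mxE mulf_eq0 negb_or => /andP[].
have g_feasible : dantzig_feasible (response X beta eps) (normalize_cols V) lambda g.
  move=> j; rewrite respE normalize_cols_mul // addrC addKr.
  apply: le_trans noise; set W := normalize_cols V.
  have -> : ((col j W)^T *m eps_star X b beta eps eta) 0 0
      = (W^T *m eps_star X b beta eps eta) j 0.
    by rewrite !mxE; apply: eq_bigr => i _; rewrite !mxE.
  exact: mx_norm_coord.
have err := dantzig_l2_error lambda_ge0 g_sparse uup g_feasible dantzig.
have g_rescale : rescale V g = A *m eta.
  apply/matrixP => j k; rewrite ord1 !mxE mulrC mulKf // l2norm_eq0 //.
have estim : `|flirti b A (rescale V ghat) t - ((basis_vec b t)^T *m eta) 0 0|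
    <= (Num.sqrt n%:R)^-1 * Cnp X b A Sp t * lambda * Num.sqrt Sp%:R.
  have -> : flirti b A (rescale V ghat) t - ((basis_vec b t)^T *m eta) 0 0
      = ((basis_vec b t)^T *m invmx A *m rescale V (ghat - g)) 0 0.
    have -> : rescale V (ghat - g) = rescale V ghat - A *m eta.
      rewrite -g_rescale; apply/matrixP => j k.
      by rewrite ord1 !mxE mulrBl.
    rewrite mulmxBr [RHS]mxE [X in _ = _ + X]mxE /flirti; congr (_ - _ 0 0).
    by rewrite -mulmxA (mulmxA (invmx A)) mulVmx // mul1mx.
  apply: (le_trans (dot_rescale_le _ _ _)).
  apply: (le_trans (ler_wpM2l (sqrtr_ge0 _) err)).
  have D0 : 1 - restricted_isometry V (2 * Sp)
      - restricted_orthogonality V Sp (2 * Sp) != 0.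
    by apply: lt0r_neq0; rewrite -addrA -opprD subr_gt0.
  have n0 : Num.sqrt n%:R != 0 :> R by rewrite gt_eqF // sqrtr_gt0 ltr0n.
  rewrite /Cnp alphaE // -/V le_eqVlt; apply/orP; left; apply/eqP.
  move: (restricted_isometry _ _) (restricted_orthogonality _ _ _) D0 => d th D0.
  by field; rewrite n0 D0.
have sup_ge : (`|basis_error b beta eta t|%:E <= sup_error b beta eta)%E.
  by apply: ereal_sup_ubound; exists t => //=; rewrite in_itv.
apply: (@le_trans _ _ ((Num.sqrt n%:R)^-1 * Cnp X b A Sp t * lambda * Num.sqrt Sp%:R
    + `|basis_error b beta eta t|)%:E); last by rewrite EFinD leeD2l.
rewrite lee_fin; apply: le_trans (lerD estim (lexx _)).
rewrite /basis_error (distrC (beta t)); exact: ler_distD.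
Qed.
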